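(* Let $L(x_1,x_2,x_3,x_4)=x_1+2x_2-x_3-2x_4$. Then the equation $L=0$ is uncommon over the integers; that is, it is not the case that for all sufficiently large $n$ and all functions $f\colon[n]\to[0,1]$ one has $t_L(f)+t_L(1-f)\ge 2^{1-4}=1/8$.
   Context: For $n\in\mathbb{N}$, $[n]=\{1,\dots,n\}$. For a linear form $L(x_1,\dots,x_k)=a_1x_1+\dots+a_kx_k$ with nonzero integer coefficients (at least one positive and one negative) and a function $f\colon[n]\to\mathbb{R}$, let $T_L(f)=\sum_{x_1,\dots,x_k\in[n],\ a_1x_1+\dots+a_kx_k=0} f(x_1)\cdots f(x_k)$ and $t_L(f)=T_L(f)/T_L(1)$, where $1$ denotes the constant function. The equation $L=0$ is called common over the integers if for all sufficiently large $n$ and all $f\colon[n]\to[0,1]$, $t_L(f)+t_L(1-f)\ge 2^{1-k}$; it is uncommon if it is not common. *)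

(* Defs.v *)
From HB Require Import structures.
From mathcomp Require Import all_boot all_order all_algebra.
From mathcomp Require Import reals.
Set Implicit Arguments.
Unset Strict Implicit.
Unset Printing Implicit Defensive.
Import Order.TTheory GRing.Theory Num.Theory.
Local Open Scope ring_scope.

Record linear_form (k : nat) := LinearForm {
  coef :> k.-tuple int;
  coef_neq0 : all (fun c : int => c != 0) coef;
  coef_pos : has (fun c : int => 0 < c) coef;
  coef_neg : has (fun c : int => c < 0) coef
}.

Definition form_eval (k : nat) (L : linear_form k) (y : 'I_k -> int) : int :=
  \sum_(i < k) tnth L i * y i.

(* The set [n] = {1, ..., n} is encoded by 'I_n, where the ordinal x stands
   for the integer x.+1 *)
Definition int_of_elt (n : nat) (x : 'I_n) : int := x.+1%:Z.

Section Common.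
Variables (R : realType) (k : nat) (L : linear_form k).

Definition T_form (n : nat) (f : 'I_n -> R) : R :=
  \sum_(x : {ffun 'I_k -> 'I_n} |
          form_eval L (fun i => int_of_elt (x i)) == 0)
    \prod_(i < k) f (x i).

Definition t_form (n : nat) (f : 'I_n -> R) : R :=
  T_form f / T_form (fun _ : 'I_n => 1).

Definition common_over_integers : Prop :=
  exists N : nat, forall n : nat, (N <= n)%N ->
    forall f : 'I_n -> R, (forall x, 0 <= f x <= 1) ->
      (2 : R) ^ (1 - k%:Z) <= t_form f + t_form (fun x => 1 - f x).

Definition uncommon_over_integers : Prop := ~ common_over_integers.

End Common.

Definition L_1212 : linear_form 4 :=
  @LinearForm 4 [tuple 1; 2; -1; -2] isT isT isT.

(* Main.v *)
Require Import Defs.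
From HB Require Import structures.
From mathcomp Require Import all_boot all_order all_algebra.
From mathcomp Require Import reals.
From mathcomp Require Import zify ssrZ ring lra.
Set Implicit Arguments.
Unset Strict Implicit.
Unset Printing Implicit Defensive.
Import Order.TTheory GRing.Theory Num.Theory.
Local Open Scope ring_scope.

(* For f on [n], let S_j(f) be the sum of f a f b f c f d over the quadruples
   with a + 2b + j = c + 2d.  Replacing f by its blow-up x |-> f(x./2) on [2n]
   changes (S_0, S_1, S_2) linearly, and the linear functionals governing the
   evolution of S_0 are two explicit eigenvectors.  Hence a single function on
   [12] for which two inequalities hold, checked by computation, yields by
   repeated blow-up counterexamples to commonness on [12 * 2^k] for all k > 0. *)

Lemma sum_eq_shift4 (m k : nat) :
  (\sum_(0 <= e < 4) (m == k + e) = (k <= m < k + 4))%N.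
Proof. by rewrite unlock /=; lia. Qed.

Section ShiftedSum.
Variable A : comNzRingType.
Implicit Types (f : nat -> A) (j n : nat).

(** Variables run over 0, ..., n-1 instead of 1, ..., n, so that [half] maps the range of length 2n
    two-to-one onto that of length n. The ring is arbitrary so that a computation in binary integers
    can be transported to the reals. *)
Definition shifted_sum j n f : A :=
  \sum_(0 <= a < n) \sum_(0 <= b < n) \sum_(0 <= c < n) \sum_(0 <= d < n)
    (a + 2 * b + j == c + 2 * d)%N%:R * (f a * f b * f c * f d).

Lemma eq_shifted_sum j n f g : f =1 g -> shifted_sum j n f = shifted_sum j n g.
Proof.
move=> fg; do 4![apply: eq_bigr => ? _].
by rewrite !fg.
Qed.

Lemma shifted_sumZ j n (k : A) f :
  shifted_sum j n (fun x => k * f x) = k ^+ 4 * shifted_sum j n f.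
Proof.
rewrite /shifted_sum; do 4![rewrite mulr_sumr; apply: eq_bigr => ? _].
by ring.
Qed.

Lemma sum_nat_double n f :
  \sum_(0 <= x < n.*2) f x = \sum_(0 <= x < n) (f x.*2 + f x.*2.+1).
Proof.
elim: n => [|n IHn]; first by rewrite !big_nil.
by rewrite doubleS !big_nat_recr //= IHn addrA.
Qed.

(** Each variable splits into its half and its parity. The parities of the first two variables
    contribute e = 0, 1, 2 or 3 to the left side, each value exactly once, and likewise e' on the
    right; [w] counts the pairs (e, e') compatible with given halves. *)
Lemma shifted_sum_half j n f (w : nat -> nat -> nat) :
  (forall s t, \sum_(0 <= e < 4) \sum_(0 <= e' < 4)
                 (2 * s + e + j == 2 * t + e') = w s t)%N ->
  shifted_sum j n.*2 (f \o half) =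
  \sum_(0 <= a < n) \sum_(0 <= b < n) \sum_(0 <= c < n) \sum_(0 <= d < n)
    (w (a + 2 * b) (c + 2 * d))%N%:R * (f a * f b * f c * f d).
Proof.
move=> wE; rewrite /shifted_sum /=.
rewrite sum_nat_double; apply: eq_bigr => a _; rewrite -big_split /=.
rewrite sum_nat_double; apply: eq_bigr => b _; rewrite -!big_split /=.
rewrite sum_nat_double; apply: eq_bigr => c _; rewrite -!big_split /=.
rewrite sum_nat_double; apply: eq_bigr => d _ /=.
rewrite !doubleK !uphalf_double -wE -!mulrDl -!natrD; congr (_%:R * _).
have E00 x y : (x.*2 + 2 * y.*2 = 2 * (x + 2 * y) + 0)%N by lia.
have E10 x y : (x.*2.+1 + 2 * y.*2 = 2 * (x + 2 * y) + 1)%N by lia.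
have E01 x y : (x.*2 + 2 * y.*2.+1 = 2 * (x + 2 * y) + 2)%N by lia.
have E11 x y : (x.*2.+1 + 2 * y.*2.+1 = 2 * (x + 2 * y) + 3)%N by lia.
by rewrite !(E00, E10, E01, E11) unlock /=; ring.
Qed.

(* Exchanging the two sides of the equation turns a shift by -1 into a shift
   by 1. *)
Lemma shifted_sum_opp1 n f :
  \sum_(0 <= a < n) \sum_(0 <= b < n) \sum_(0 <= c < n) \sum_(0 <= d < n)
    (a + 2 * b == c + 2 * d + 1)%N%:R * (f a * f b * f c * f d) =
  shifted_sum 1 n f.
Proof.
under eq_bigr => a _ do rewrite exchange_big.
rewrite exchange_big /shifted_sum; apply: eq_bigr => c _ /=.
under eq_bigr => a _ do rewrite exchange_big.
rewrite exchange_big; apply: eq_bigr => d _ /=.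
apply: eq_bigr => a _; apply: eq_bigr => b _.
by rewrite eq_sym; congr (_ * _); ring.
Qed.

Lemma shifted_sum0_half n f :
  shifted_sum 0 n.*2 (f \o half) =
  4 * shifted_sum 0 n f + 4 * shifted_sum 1 n f.
Proof.
(* Of the 16 pairs (e, e'), four have e = e', two have e - e' = 2 and two have e' - e = 2. *)
pose w s t := (4 * (s + 0 == t) + 2 * (s + 1 == t) + 2 * (s == t + 1))%N.
rewrite (@shifted_sum_half 0 n f w); last first.
  move=> s t; under eq_bigr => e _ do rewrite sum_eq_shift4.
  by rewrite unlock /w /=; lia.
transitivity (4 * shifted_sum 0 n f + 2 * shifted_sum 1 n f
              + 2 * shifted_sum 1 n f); last by ring.
rewrite -{2}shifted_sum_opp1 /shifted_sum.
do 4![rewrite !mulr_sumr -!big_split /=; apply: eq_bigr => ? _].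
by rewrite /w; ring.
Qed.

Lemma shifted_sum1_half n f :
  shifted_sum 1 n.*2 (f \o half) =
  3 * shifted_sum 0 n f + 4 * shifted_sum 1 n f + shifted_sum 2 n f.
Proof.
pose w s t :=
  (3 * (s + 0 == t) + 3 * (s + 1 == t) + (s == t + 1) + (s + 2 == t))%N.
rewrite (@shifted_sum_half 1 n f w); last first.
  move=> s t; under eq_bigr => e _ do rewrite sum_eq_shift4.
  by rewrite unlock /w /=; lia.
transitivity (3 * shifted_sum 0 n f + 3 * shifted_sum 1 n f
              + shifted_sum 1 n f + shifted_sum 2 n f); last by ring.
rewrite -{2}shifted_sum_opp1 /shifted_sum.
do 4![rewrite !mulr_sumr -!big_split /=; apply: eq_bigr => ? _].
by rewrite /w; ring.
Qed.

Lemma shifted_sum2_half n f :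
  shifted_sum 2 n.*2 (f \o half) =
  2 * shifted_sum 0 n f + 4 * shifted_sum 1 n f + 2 * shifted_sum 2 n f.
Proof.
(* Having t - s = 3 or t - s = -1 would require e and e' to differ by 4, so no shift beyond 2 arises
   and the recursion closes. *)
pose w s t := (2 * (s + 0 == t) + 4 * (s + 1 == t) + 2 * (s + 2 == t))%N.
rewrite (@shifted_sum_half 2 n f w); last first.
  move=> s t; under eq_bigr => e _ do rewrite sum_eq_shift4.
  by rewrite unlock /w /=; lia.
rewrite /shifted_sum.
do 4![rewrite !mulr_sumr -!big_split /=; apply: eq_bigr => ? _].
by rewrite /w; ring.
Qed.

(* Negative at shift 0 exactly when f / D violates the bound 1/8. *)
Definition excess (D : A) j n f : A :=
  8 * (shifted_sum j n f + shifted_sum j n (fun x => D - f x))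
  - shifted_sum j n (fun=> D).

Lemma excess0_half (D : A) n f :
  excess D 0 n.*2 (f \o half) = 4 * excess D 0 n f + 4 * excess D 1 n f.
Proof.
have /= E0 := shifted_sum0_half n (fun x => D - f x).
have /= E1 := shifted_sum0_half n (fun=> D).
by rewrite /excess shifted_sum0_half E0 E1; ring.
Qed.

Lemma excess1_half (D : A) n f :
  excess D 1 n.*2 (f \o half) =
  3 * excess D 0 n f + 4 * excess D 1 n f + excess D 2 n f.
Proof.
have /= E0 := shifted_sum1_half n (fun x => D - f x).
have /= E1 := shifted_sum1_half n (fun=> D).
by rewrite /excess shifted_sum1_half E0 E1; ring.
Qed.

Lemma excess2_half (D : A) n f :
  excess D 2 n.*2 (f \o half) =
  2 * excess D 0 n f + 4 * excess D 1 n f + 2 * excess D 2 n f.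
Proof.
have /= E0 := shifted_sum2_half n (fun x => D - f x).
have /= E1 := shifted_sum2_half n (fun=> D).
by rewrite /excess shifted_sum2_half E0 E1; ring.
Qed.

End ShiftedSum.

Lemma rmorph_shifted_sum (A B : comNzRingType) (phi : {rmorphism A -> B})
    j n (f : nat -> A) :
  phi (shifted_sum j n f) = shifted_sum j n (phi \o f).
Proof.
rewrite /shifted_sum; do 4![rewrite rmorph_sum; apply: eq_bigr => ? _].
by rewrite /= !rmorphM rmorph_nat.
Qed.

Lemma rmorph_excess (A B : comNzRingType) (phi : {rmorphism A -> B})
    (D : A) j n (f : nat -> A) :
  phi (excess D j n f) = excess (phi D) j n (phi \o f).
Proof.
rewrite /excess rmorphB rmorphM rmorph_nat rmorphD !rmorph_shifted_sum.
congr (_ * (_ + _) - _).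
by apply: eq_shifted_sum => x /=; rewrite rmorphB.
Qed.

(* The two hypotheses are preserved by doubling: the combinations
   5 E0 + 6 E1 + E2 and E0 - E2 are left eigenvectors of the recursion, with
   eigenvalues 8 and 2, and the new E0 is 2/3 of their sum. *)
Lemma excess_iter_half_lt0 (R : realFieldType) (D : R) n (f : nat -> R) k :
  5 * excess D 0 n f + 6 * excess D 1 n f + excess D 2 n f < 0 ->
  excess D 0 n f - excess D 2 n f < 0 ->
  excess D 0 (iter k.+1 double n) (f \o iter k.+1 half) < 0.
Proof.
elim: k n f => [|k IHk] n f lt1 lt2; first by rewrite excess0_half; lra.
rewrite iterSr; apply: (IHk n.*2 (f \o half)).
  by rewrite excess0_half excess1_half excess2_half; lra.
by rewrite excess0_half excess2_half; lra.
Qed.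

(* Percentages found by rounding a multiple of an eigenvector, of negative
   eigenvalue, of the quadratic part of the excess around the constant 1/2. *)
Definition seed : seq nat :=
  [:: 51; 45; 55; 55; 44; 50; 50; 44; 55; 55; 45; 51].

(** Working over the common denominator 100 in binary integers keeps the sums over 12^4 quadruples
    within reach of [vm_compute]. *)
Definition seed_Z (x : nat) : BinInt.Z := BinInt.Z.of_nat (nth 0%N seed x).

Definition hundred_Z : BinInt.Z := BinInt.Z.of_nat 100.

Definition seed_excess j := excess hundred_Z j 12 seed_Z.

Lemma seed_excess_lt0 :
  5 * seed_excess 0 + 6 * seed_excess 1 + seed_excess 2 < 0.
Proof. by rewrite /seed_excess /excess /shifted_sum unlock; vm_compute. Qed.

Lemma seed_excess_lt : seed_excess 0 - seed_excess 2 < 0.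
Proof. by rewrite /seed_excess /excess /shifted_sum unlock; vm_compute. Qed.

Section Blowup.
Variable R : realType.

Let ZtoR : {rmorphism BinInt.Z -> R} := intr \o int_of_Z.

Let ZtoR_lt0 z : z < 0 -> ZtoR z < 0.
Proof. by rewrite /= ltrz0; case: z. Qed.

Let ZtoR_nat m : ZtoR (BinInt.Z.of_nat m) = m%:R.
Proof. by rewrite pmulrn /=; congr (_%:~R); lia. Qed.

Let seed_R (x : nat) : R := (nth 0%N seed x)%:R.

Lemma seed_blowup_excess_lt0 k :
  excess 100 0 (iter k.+1 double 12) (seed_R \o iter k.+1 half) < 0.
Proof.
have seedE x : seed_R x = (ZtoR \o seed_Z) x by rewrite [RHS]ZtoR_nat.
have E j : excess 100 j 12 seed_R = ZtoR (seed_excess j).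
  rewrite rmorph_excess ZtoR_nat /excess; congr (_ * (_ + _) - _);
    by apply: eq_shifted_sum => x; rewrite seedE.
apply: excess_iter_half_lt0; rewrite !E.
  have := ZtoR_lt0 seed_excess_lt0.
  by rewrite rmorphD [ZtoR (5 * _ + _)]rmorphD 2!rmorphM !rmorph_nat.
by have := ZtoR_lt0 seed_excess_lt; rewrite rmorphB.
Qed.

End Blowup.

Lemma T_form_L_1212 (R : realType) n (g : nat -> R) :
  T_form L_1212 (fun x : 'I_n => g x) = shifted_sum 0 n g.
Proof.
pose F (p : ('I_n * 'I_n) * ('I_n * 'I_n)) : {ffun 'I_4 -> 'I_n} :=
  [ffun i => tnth [tuple p.1.1; p.1.2; p.2.1; p.2.2] i].
pose G (x : {ffun 'I_4 -> 'I_n}) :=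
  ((x (inord 0), x (inord 1)), (x (inord 2), x (inord 3))).
have FG : cancel F G.
  move=> [[a b] [c d]]; rewrite /F /G !ffunE.
  by rewrite !(tnth_nth a) !inordK.
have GF : cancel G F.
  move=> x; apply/ffunP => i; rewrite /F /G ffunE (tnth_nth (x i)) /=.
  by case: i => [[|[|[|[|]]]] lti] //=; congr (x _); apply: val_inj;
    rewrite /= inordK.
rewrite /T_form big_mkcond (reindex F) /=; last by exists G.
transitivity (\sum_(a < n) \sum_(b < n) \sum_(c < n) \sum_(d < n)
  (a + 2 * b + 0 == c + 2 * d)%N%:R * (g a * g b * g c * g d)); last first.
  by rewrite /shifted_sum; do 4![rewrite big_mkord; apply: eq_bigr => ? _].
rewrite pair_bigA; under [RHS]eq_bigr do rewrite pair_bigA.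
rewrite pair_bigA; apply: eq_bigr => -[[a b] [c d]] _ /=.
rewrite /form_eval !big_ord_recl !big_ord0 /= !ffunE /= /int_of_elt.
rewrite !(tnth_nth 0) !(tnth_nth a) /= mulr1 !mulrA.
(* An ordinal x stands for x + 1; these offsets cancel because the coefficients 1, 2, -1, -2 sum to
   zero. *)
rewrite (_ : (_ == 0) = (a + 2 * b + 0 == c + 2 * d)%N); last by lia.
by case: ifP => _; rewrite ?mul1r ?mul0r.
Qed.

Theorem theorem1p1 (R : realType) : uncommon_over_integers R L_1212.
Proof.
move=> [N commonN].
pose n := iter N.+1 double 12.
have ltNn : (N < n)%N.
  by rewrite /n; elim: (N) => // k IHk; rewrite iterS; lia.
pose F : nat -> R := (fun x => (nth 0%N seed x)%:R) \o iter N.+1 half.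
have F_le x : 0 <= F x <= 100.
  rewrite ler0n ler_nat.
  have /allP seed_le : all (fun m => m <= 100)%N seed by [].
  (* Past the end of [seed], [nth] returns 0, which also satisfies the bound. *)
  rewrite /F /=; set y := half _; have [lty|ley] := ltnP y (size seed).
    exact/seed_le/mem_nth.
  by rewrite nth_default.
pose f (x : nat) : R := 100^-1 * F x.
have f_le x : 0 <= f x <= 1 by have := F_le x; rewrite /f; lra.
have := commonN n (ltnW ltNn) (fun x => f x) (fun x => f_le x).
rewrite (_ : 2 ^ (1 - 4%:Z) = 8^-1 :> R); last first.
  by rewrite -[1 - 4%:Z]/(- 3%:Z) -exprnN -natrX.
have T_ge0 (h : nat -> R) :
    (forall x, 0 <= h x) -> 0 <= T_form L_1212 (fun x : 'I_n => h x).
  by move=> h_ge0; apply: sumr_ge0 => x _; apply: prodr_ge0 => i _.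
have Tf_ge0 : 0 <= T_form L_1212 (fun x : 'I_n => f x).
  by apply: T_ge0 => x; have /andP[] := f_le x.
have TCf_ge0 : 0 <= T_form L_1212 (fun x : 'I_n => 1 - f x).
  apply: (T_ge0 (fun x => 1 - f x)) => x; rewrite subr_ge0.
  by have /andP[] := f_le x.
have := seed_blowup_excess_lt0 R N; rewrite -/n -/F /excess => excess_lt0.
(* By homogeneity of degree 4, rescaling from 100 to 1 divides all three sums in the excess by 100^4
   and keeps its sign. *)
have Tlt : 8 * (T_form L_1212 (fun x : 'I_n => f x) +
                T_form L_1212 (fun x : 'I_n => 1 - f x))
           < T_form L_1212 (fun _ : 'I_n => 1 : R).
  rewrite (T_form_L_1212 n f) (T_form_L_1212 n (fun x => 1 - f x)).
  rewrite (T_form_L_1212 n (fun=> 1)) /f shifted_sumZ.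
  have -> : shifted_sum 0 n (fun x => 1 - 100^-1 * F x) =
            100 ^- 4 * shifted_sum 0 n (fun x => 100 - F x).
    by rewrite -exprVn -shifted_sumZ; apply: eq_shifted_sum => x; field.
  have -> : shifted_sum 0 n (fun=> 1 : R) =
            100 ^- 4 * shifted_sum 0 n (fun=> 100).
    by rewrite -exprVn -shifted_sumZ; apply: eq_shifted_sum => x; field.
  by rewrite exprVn; move: excess_lt0; lra.
(* The denominator is positive because [Tlt] bounds it below by a nonnegative quantity, strictly. *)
rewrite /t_form -mulrDl ler_pdivlMr; last by lra.
by rewrite leNgt => /negP; apply; lra.
Qed.
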